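(* Let $p$ be a prime and $m\ge 1$ an integer. Let $\phi:A\to B$ be a homomorphism of groups that induces an isomorphism $H_1(A;\mathbb{Z}_p)\to H_1(B;\mathbb{Z}_p)$ and such that the composite $H_2(A;\mathbb{Z}_p)\xrightarrow{\phi_*}H_2(B;\mathbb{Z}_p)\to H_2(B;\mathbb{Z}_p)/\Phi_{p,m}(B)$ is an epimorphism. Then for any $n\le m+1$, $\phi$ induces an isomorphism $A/A_{p,n}\to B/B_{p,n}$.
   Context: $\mathbb{Z}_p$ denotes the integers modulo $p$. For a group $G$, the $p$-lower central series $\{G_{p,n}\}_{n\ge 1}$ is defined by $G_{p,1}=G$ and $G_{p,n+1}=(G_{p,n})^p[G_{p,n},G]$, i.e. the subgroup generated by $p$-th powers of elements of $G_{p,n}$ and commutators of elements of $G_{p,n}$ with elements of $G$. For a group $B$, $\Phi_{p,m}(B)$ denotes the kernel of the map $H_2(B;\mathbb{Z}_p)\to H_2(B/B_{p,m};\mathbb{Z}_p)$ induced by the quotient map. *)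

(* Defs.v *)
From HB Require Import structures.
From mathcomp Require Import finmap monalg.
From mathcomp Require Import all_boot all_algebra boolp zify.

Set Implicit Arguments.
Unset Strict Implicit.
Unset Printing Implicit Defensive.

Import GRing.Theory.

Local Open Scope ring_scope.
Local Open Scope quotient_scope.

HB.mixin Record isConjClosed (G : groupType) (S : {pred G}) := {
  gpredJr : forall x y, x \in S -> (x ^ y)%g \in S
}.

#[short(type="normalClosed")]
HB.structure Definition NormalClosed (G : groupType) :=
  {S of isConjClosed G S & GroupClosed G S}.

Section QuotientGroup.
Variables (G : groupType) (N : normalClosed G).

Definition gequiv (x y : G) := (x^-1 * y)%g \in N.

Lemma gequiv_is_equiv : equiv_class_of gequiv.
Proof.
split=> [x|x y|y x z]; rewrite /gequiv ?mulVg ?gpred1 //.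
  by rewrite -gpredV invgM invgK.
move=> xy yz; suff -> : (x^-1 * z = (x^-1 * y) * (y^-1 * z))%g by exact: gpredM.
by rewrite mulgA mulgK.
Qed.

Canonical gequiv_equiv := EquivRelPack gequiv_is_equiv.
Canonical gequiv_encModRel := defaultEncModRel gequiv.

Definition quotg := {eq_quot gequiv}.

HB.instance Definition _ : EqQuotient G gequiv quotg := EqQuotient.on quotg.
HB.instance Definition _ := Choice.on quotg.

Definition gproj (x : G) : quotg := \pi_quotg x.

Lemma gprojP x y : reflect (gproj x = gproj y) ((x^-1 * y)%g \in N).
Proof. by apply: (iffP idP) => [|/eqP]; [move=> xy; apply/eqP|]; rewrite piE. Qed.

Lemma gproj_repr (q : quotg) : gproj (repr q) = q.
Proof. exact: reprK. Qed.

Definition quotg_one : quotg := gproj 1%g.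
Definition quotg_mul (a b : quotg) : quotg := gproj (repr a * repr b)%g.
Definition quotg_inv (a : quotg) : quotg := gproj (repr a)^-1%g.

Lemma quotg_mulE x y : quotg_mul (gproj x) (gproj y) = gproj (x * y)%g.
Proof.
apply/gprojP.
set x' := repr _; set y' := repr _.
have xN : (x'^-1 * x)%g \in N by apply/gprojP; rewrite gproj_repr.
have yN : (y'^-1 * y)%g \in N by apply/gprojP; rewrite gproj_repr.
have -> : ((x' * y')^-1 * (x * y) = (x'^-1 * x) ^ y' * (y'^-1 * y))%g.
  by rewrite invgM /conjg !mulgA mulgK.
by rewrite gpredM // gpredJr.
Qed.

Lemma quotg_invE x : quotg_inv (gproj x) = gproj x^-1%g.
Proof.
apply/gprojP; set x' := repr _.
have xN : (x'^-1 * x)%g \in N by apply/gprojP; rewrite gproj_repr.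
have -> : (x'^-1^-1 * x^-1 = ((x'^-1 * x)^-1) ^ x'^-1)%g.
  by rewrite /conjg invgM !invgK !mulgA mulgK.
by rewrite gpredJr // gpredV.
Qed.

Lemma quotg_mulA : associative quotg_mul.
Proof.
move=> x y z; rewrite -[x]gproj_repr -[y]gproj_repr -[z]gproj_repr.
by rewrite !quotg_mulE mulgA.
Qed.

Lemma quotg_mul1 : left_id quotg_one quotg_mul.
Proof. by move=> x; rewrite -[x]gproj_repr quotg_mulE mul1g. Qed.

Lemma quotg_mulr1 : right_id quotg_one quotg_mul.
Proof. by move=> x; rewrite -[x]gproj_repr quotg_mulE mulg1. Qed.

Lemma quotg_mulV : left_inverse quotg_one quotg_inv quotg_mul.
Proof. by move=> x; rewrite -[x]gproj_repr quotg_invE quotg_mulE mulVg. Qed.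

Lemma quotg_mulrV : right_inverse quotg_one quotg_inv quotg_mul.
Proof. by move=> x; rewrite -[x]gproj_repr quotg_invE quotg_mulE mulgV. Qed.

HB.instance Definition _ := isGroup.Build quotg
  quotg_mulA quotg_mul1 quotg_mulr1 quotg_mulV quotg_mulrV.

Lemma gproj_is_mul : {morph gproj : x y / (x * y)%g}.
Proof. by move=> x y; rewrite -quotg_mulE. Qed.

HB.instance Definition _ := isMultiplicative.Build G quotg gproj gproj_is_mul.

End QuotientGroup.

(* Group homomorphisms are {multiplicative G -> H}: between groups, preserving *)
(* products suffices (gmul_f1, gmul_fV).                                      *)
Section QuotientMap.
Variables (G H : groupType) (N : normalClosed G) (M : normalClosed H).
Variables (f : {multiplicative G -> H}).

(* Well defined on cosets only when f maps N into M; see quotg_mapE. *)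
Definition quotg_map (q : quotg N) : quotg M := gproj M (f (repr q)).

Lemma gmul_f1 : f 1%g = 1%g.
Proof. by apply: (mulgI (f 1%g)); rewrite -gmulfM !mulg1. Qed.

Lemma gmul_fV x : f x^-1%g = (f x)^-1%g.
Proof. by apply: (mulgI (f x)); rewrite -gmulfM !mulgV gmul_f1. Qed.

Hypothesis fNM : {homo f : x / x \in N >-> x \in M}.

Lemma quotg_mapE x : quotg_map (gproj N x) = gproj M (f x).
Proof.
apply/gprojP; rewrite -gmul_fV -gmulfM fNM //.
by apply/gprojP; rewrite gproj_repr.
Qed.

Lemma quotg_map_is_mul : {morph quotg_map : x y / (x * y)%g}.
Proof.
move=> x y; rewrite -[x]gproj_repr -[y]gproj_repr.
move: (repr x) (repr y) => a b.
by rewrite -gproj_is_mul !quotg_mapE gmulfM gproj_is_mul.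
Qed.

End QuotientMap.

Section Generated.
Variables (G : groupType) (S : G -> Prop).

Definition gen : {pred G} :=
  fun x => `[< forall K : groupClosed G, (forall s, S s -> s \in K) -> x \in K >].

Lemma genP x :
  reflect (forall K : groupClosed G, (forall s, S s -> s \in K) -> x \in K)
          (x \in gen).
Proof. exact: asboolP. Qed.

Lemma sub_gen s : S s -> s \in gen.
Proof. by move=> Ss; apply/genP => K; apply. Qed.

Lemma gen_mul_closed : mulg_closed gen.
Proof.
by move=> x y /genP Sx /genP Sy; apply/genP => K SK; rewrite gpredM ?Sx ?Sy.
Qed.

Lemma gen1 : 1%g \in gen.
Proof. by apply/genP => K _; rewrite gpred1. Qed.

Lemma gen_inv_closed : invg_closed gen.
Proof. by move=> x /genP Sx; apply/genP => K SK; rewrite gpredV Sx. Qed.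

HB.instance Definition _ := isMulClosed.Build G gen gen_mul_closed.
HB.instance Definition _ := isMul1Closed.Build G gen gen1.
HB.instance Definition _ := isInvClosed.Build G gen gen_inv_closed.

End Generated.

Section PreimPred.
Variables (G H : groupType) (f : {multiplicative G -> H}) (K : groupClosed H).

Definition gpreim : {pred G} := fun x => f x \in K.

Lemma gpreim_mul_closed : mulg_closed gpreim.
Proof. by move=> x y xK yK; rewrite unfold_in gmulfM gpredM. Qed.

Lemma gpreim1 : 1%g \in gpreim.
Proof. by rewrite unfold_in gmul_f1 gpred1. Qed.

Lemma gpreim_inv_closed : invg_closed gpreim.
Proof. by move=> x xK; rewrite unfold_in gmul_fV gpredV. Qed.

HB.instance Definition _ := isMulClosed.Build G gpreim gpreim_mul_closed.
HB.instance Definition _ := isMul1Closed.Build G gpreim gpreim1.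
HB.instance Definition _ := isInvClosed.Build G gpreim gpreim_inv_closed.

End PreimPred.

Lemma gen_homo (G H : groupType) (f : {multiplicative G -> H})
    (S : G -> Prop) (T : H -> Prop) :
  (forall s, S s -> T (f s)) -> {homo f : x / x \in gen S >-> x \in gen T}.
Proof.
move=> ST x /genP /(_ (gpreim f (gen T))); apply=> s /ST; exact: sub_gen.
Qed.

(* lower_pcentral p G n is G_{p,n}; the index starts at 1, and the value at   *)
(* n = 0 is a dummy.                                                          *)
Fixpoint lower_pcentral (p : nat) (G : groupType) (n : nat) : {pred G} :=
  if n is (_.+1 as k).+1 then
    gen (fun z =>
      (exists2 x, x \in @lower_pcentral p G k & z = (x ^+ p)%g) \/
      (exists2 x, x \in @lower_pcentral p G k & exists y, z = [~ x, y]%g))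
  else predT.

Arguments lower_pcentral : clear implicits.

Section LowerPCentral.
Variables (p : nat) (G : groupType).

Lemma lower_pcentral_mul_closed n : mulg_closed (lower_pcentral p G n).
Proof. by case: n => [|[|n]] x y //; apply: gpredM. Qed.

Lemma lower_pcentral1 n : 1%g \in lower_pcentral p G n.
Proof. by case: n => [|[|n]] //; apply: gpred1. Qed.

Lemma lower_pcentral_inv_closed n : invg_closed (lower_pcentral p G n).
Proof. by case: n => [|[|n]] x //; apply: gpredVr. Qed.

HB.instance Definition _ n :=
  isMulClosed.Build G (lower_pcentral p G n) (@lower_pcentral_mul_closed n).
HB.instance Definition _ n :=
  isMul1Closed.Build G (lower_pcentral p G n) (lower_pcentral1 n).
HB.instance Definition _ n :=
  isInvClosed.Build G (lower_pcentral p G n) (@lower_pcentral_inv_closed n).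

End LowerPCentral.

Lemma gmul_fX (G H : groupType) (f : {multiplicative G -> H}) x n :
  f (x ^+ n)%g = (f x ^+ n)%g.
Proof. by elim: n => [|n IHn]; rewrite ?gmul_f1 // !expgS gmulfM IHn. Qed.

Lemma gmul_fR (G H : groupType) (f : {multiplicative G -> H}) x y :
  f [~ x, y]%g = [~ f x, f y]%g.
Proof. by rewrite !gmulfM !gmul_fV. Qed.

Lemma lower_pcentral_homo p n (G H : groupType) (f : {multiplicative G -> H}) :
  {homo f : x / x \in lower_pcentral p G n >-> x \in lower_pcentral p H n}.
Proof.
elim: n => [|[|n] IHn] // x; apply: gen_homo => z [[y yG ->]|[y yG [w ->]]].
  by left; exists (f y); rewrite ?gmul_fX // IHn.
by right; exists (f y); [exact: IHn | exists (f w); rewrite gmul_fR].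
Qed.

Section LowerPCentralNormal.
Variables (p : nat) (G : groupType).

Lemma conj_is_mul (y : G) : {morph conjg^~ y : x z / (x * z)%g}.
Proof. by move=> x z; rewrite conjMg. Qed.

Lemma lower_pcentral_conj n x y :
  x \in lower_pcentral p G n -> (x ^ y)%g \in lower_pcentral p G n.
Proof.
pose m := isMultiplicative.Build G G (conjg^~ y) (@conj_is_mul y).
pose c : {multiplicative G -> G} := HB.pack (conjg^~ y) m.
exact: (@lower_pcentral_homo p n G G c x).
Qed.

HB.instance Definition _ n :=
  isConjClosed.Build G (lower_pcentral p G n) (@lower_pcentral_conj n).

End LowerPCentralNormal.

Definition pcentral_quot (p : nat) (G : groupType) (n : nat) : groupType :=
  quotg (lower_pcentral p G n).

Definition pcentral_proj (p : nat) (G : groupType) (n : nat) :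
  {multiplicative G -> pcentral_quot p G n} := gproj (lower_pcentral p G n).

Section PCentralMap.
Variables (p : nat) (G H : groupType) (f : {multiplicative G -> H}) (n : nat).

Definition pcentral_map : pcentral_quot p G n -> pcentral_quot p H n :=
  quotg_map (lower_pcentral p H n) f.

Lemma pcentral_mapE x :
  pcentral_map (pcentral_proj p G n x) = pcentral_proj p H n (f x).
Proof. exact/quotg_mapE/lower_pcentral_homo. Qed.

Lemma pcentral_map_is_mul : {morph pcentral_map : x y / (x * y)%g}.
Proof. exact/quotg_map_is_mul/lower_pcentral_homo. Qed.

HB.instance Definition _ :=
  isMultiplicative.Build _ _ pcentral_map pcentral_map_is_mul.

End PCentralMap.

Arguments pcentral_map p {G H} f n.

Section LinExt.
Variables (R : nzRingType) (K : choiceType) (V : lmodType R) (h : K -> V).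

Definition linext (c : {malg R[K]}) : V := \sum_(k <- msupp c) c@_k *: h k.

Lemma linextEw (D : {fset K}) c : (msupp c `<=` D)%fset ->
  linext c = \sum_(k <- D) c@_k *: h k.
Proof.
move=> cD; rewrite /linext (big_fset_incl _ cD) // => k _ /mcoeff_outdom ->.
by rewrite scale0r.
Qed.

Lemma linext_is_linear : linear linext.
Proof.
move=> a c d; pose D := (msupp c `|` msupp d `|` msupp (a *: c + d))%fset.
have cD : (msupp c `<=` D)%fset by rewrite /D -fsetUA fsubsetUl.
have dD : (msupp d `<=` D)%fset.
  exact: fsubset_trans (fsubsetUr _ _) (fsubsetUl _ _).
rewrite (linextEw cD) (linextEw dD) (linextEw (fsubsetUr _ _ : _ `<=` D)%fset).
rewrite scaler_sumr -big_split; apply: eq_bigr => k _ /=.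
by rewrite mcoeffD mcoeffZ scalerDl scalerA.
Qed.

HB.instance Definition _ := GRing.isLinear.Build R {malg R[K]} V _ linext
  linext_is_linear.

Lemma linextU a k : linext << a *g k >> = a *: h k.
Proof. by rewrite (@linextEw [fset k]%fset) ?msuppU_le // big_seq_fset1 mcoeffUU. Qed.

End LinExt.

Lemma malgZU (R : nzRingType) (K : choiceType) (a b : R) (k : K) :
  a *: << b *g k >> = << a * b *g k >> :> {malg R[K]}.
Proof. by apply/malgP => k'; rewrite mcoeffZ !mcoeffU mulrnAr. Qed.

Lemma linext_ext (R : nzRingType) (K : choiceType) (V : lmodType R)
    (F F' : {linear {malg R[K]} -> V}) :
  (forall k, F << k >> = F' << k >>) -> F =1 F'.
Proof.
move=> FF' c; rewrite [c]monalgE !linear_sum; apply: eq_bigr => k _ /=.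
by rewrite -[c@_k]mulr1 -malgZU !linearZ /= FF'.
Qed.

Lemma alt_sum0 (V : zmodType) n (F : nat -> nat -> V) :
  (forall j i, (i <= j)%N -> F j.+1 i = - F i j) ->
  \sum_(j < n.+1) \sum_(i < n) F j i = 0.
Proof.
move=> FN.
under eq_bigr => j _ do rewrite (bigID (fun i : 'I_n => (i < j)%N)) /=.
rewrite big_split /= big_ord_recl [X in _ + X]big_ord_recr /=.
rewrite big_pred0 // add0r [X in _ + (_ + X)]big_pred0 => [|i]; last first.
  by rewrite ltn_ord.
rewrite addr0 [X in _ + X](exchange_big_dep predT) //= -big_split /=.
apply: big1 => j _; under eq_bigl => i do rewrite /bump leq0n add1n ltnS.
under [X in _ + X]eq_bigl => i do rewrite -leqNgt.
rewrite -big_split big1 // => i ij /=; rewrite /bump leq0n add1n.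
by rewrite FN // addNr.
Qed.

(* Group homology with trivial coefficients in R, as the homology of the      *)
(* complex of inhomogeneous bar chains: degree n is free on [g_1|...|g_n],    *)
(* and the differential is the alternating sum of the faces                   *)
(*   d_0 [g_1|...|g_n] = [g_2|...|g_n],                                       *)
(*   d_i [g_1|...|g_n] = [g_1|...|g_i g_{i+1}|...|g_n]  for 0 < i < n,        *)
(*   d_n [g_1|...|g_n] = [g_1|...|g_{n-1}].                                   *)
Section BarComplex.
Variables (R : nzRingType) (G : groupType).

Definition bar (n : nat) : lmodType R := {malg R[n.-tuple G]}.

(* As t is indexed from 0, lift ord_max j and lift ord0 j are the positions   *)
(* j and j.+1 of t.                                                           *)
Definition bar_face n (i : nat) (t : n.+1.-tuple G) : n.-tuple G :=
  [tuple if (j.+1 < i)%N then tnth t (lift ord_max j)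
         else if j.+1 == i then
           (tnth t (lift ord_max j) * tnth t (lift ord0 j))%g
         else tnth t (lift ord0 j) | j < n].

Definition bar_diff n : bar n.+1 -> bar n :=
  linext (fun t => \sum_(i < n.+2) (-1) ^+ i *: << bar_face i t >>).

HB.instance Definition _ n := GRing.Linear.on (@bar_diff n).

Lemma bar_diffU n (t : n.+1.-tuple G) :
  bar_diff << t >> = \sum_(i < n.+2) (-1) ^+ i *: << bar_face i t >>.
Proof. by rewrite /bar_diff linextU scale1r. Qed.

Lemma bar_face_nth n i (t : n.+1.-tuple G) j : (j < n)%N ->
  nth 1%g (bar_face i t) j =
  if (j.+1 < i)%N then nth 1%g t j
  else if j.+1 == i then (nth 1%g t j * nth 1%g t j.+1)%g
  else nth 1%g t j.+1.
Proof.
move=> jn; rewrite -[j]/(val (Ordinal jn)) -tnth_nth tnth_mktuple.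
by rewrite !(tnth_nth 1%g) lift_max lift0.
Qed.

Lemma bar_face_face n i j (t : n.+2.-tuple G) : (i <= j)%N ->
  bar_face i (bar_face j.+1 t) = bar_face j (bar_face i t).
Proof.
move=> ij; apply: eq_from_tnth => k; rewrite !(tnth_nth 1%g).
have kn := ltn_ord k; do ?rewrite bar_face_nth; try lia.
do ?[case: ifP => ?]; rewrite ?mulgA //; lia.
Qed.

Lemma bar_diff_diff n (c : bar n.+2) : bar_diff (bar_diff c) = 0.
Proof.
pose d : {linear bar n.+2 -> bar n} := @bar_diff n \o @bar_diff n.+1.
suff dE : d =1 (\0 : bar n.+2 -> bar n) by exact: dE.
apply: linext_ext => t /=.
rewrite bar_diffU linear_sum /=.
under eq_bigr => j _ do rewrite linearZ /= bar_diffU scaler_sumr.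
under eq_bigr => j _ do under eq_bigr => i _ do rewrite scalerA -exprD.
pose F (j i : nat) : bar n := (-1) ^+ (j + i) *: << bar_face i (bar_face j t) >>.
apply: (@alt_sum0 _ _ F) => j i ij.
by rewrite /F bar_face_face // addSn exprS mulN1r scaleNr addnC.
Qed.

End BarComplex.

Section Kernel.
Variables (U V : zmodType) (f : {additive U -> V}).

Definition kernel : {pred U} := fun x => f x == 0.

Lemma kernelP x : reflect (f x = 0) (x \in kernel).
Proof. exact: eqP. Qed.

Lemma kernel_zmod_closed : zmod_closed kernel.
Proof.
split=> [|x y /kernelP fx /kernelP fy]; apply/kernelP; first exact: raddf0.
by rewrite raddfB fx fy subr0.
Qed.

HB.instance Definition _ := GRing.isZmodClosed.Build U kernel kernel_zmod_closed.

End Kernel.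

Section Homology.
Variables (R : nzRingType) (G : groupType) (n : nat).

Definition bar_cycle : {pred bar R G n} :=
  match n return {pred bar R G n} with
  | 0 => predT
  | k.+1 => kernel (@bar_diff R G k)
  end.

Lemma cycle_zmod_closed : zmod_closed bar_cycle.
Proof. by rewrite /bar_cycle; case: n => [|k]; last exact: kernel_zmod_closed. Qed.

HB.instance Definition _ :=
  GRing.isZmodClosed.Build (bar R G n) bar_cycle cycle_zmod_closed.

Definition bar_cycles : Type := {c : bar R G n | c \in bar_cycle}.

HB.instance Definition _ := [isSub of bar_cycles for @sval _ _].
HB.instance Definition _ := [Choice of bar_cycles by <:].
HB.instance Definition _ := [SubChoice_isSubZmodule of bar_cycles by <:].

(* By bar_diff_diff, the condition that the boundary of c lies among the      *)
(* cycles excludes no c.                                                      *)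
Definition bar_boundary : {pred bar_cycles} :=
  fun z => `[< exists c : bar R G n.+1, \val z = bar_diff c >].

Lemma boundary_zmod_closed : zmod_closed bar_boundary.
Proof.
split=> [|y z /asboolP [c yc] /asboolP [d zd]]; apply/asboolP.
  by exists 0; rewrite [RHS]raddf0; apply: raddf0.
by exists (c - d); rewrite [RHS]linearB /= -yc -zd.
Qed.

HB.instance Definition _ :=
  GRing.isZmodClosed.Build bar_cycles bar_boundary boundary_zmod_closed.

Definition homology : zmodType := Quotient.quot bar_boundary.

Definition hclass (z : bar_cycles) : homology :=
  \pi_(Quotient.quot bar_boundary) z.

Lemma hclass_is_zmod : zmod_morphism hclass.
Proof. exact: (pi_is_zmod_morphism (Quotient.quot bar_boundary)). Qed.

HB.instance Definition _ :=
  GRing.isZmodMorphism.Build bar_cycles homology hclass hclass_is_zmod.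

Lemma hclass_repr (x : homology) : hclass (repr x) = x.
Proof. exact: reprK. Qed.

Lemma hclassP y z : reflect (hclass y = hclass z) (y - z \in bar_boundary).
Proof. by rewrite Quotient.idealrBE; apply: eqP. Qed.

End Homology.

Arguments bar_cycle : clear implicits.
Arguments bar_boundary : clear implicits.

Section HomologyMap.
Variables (R : nzRingType) (G H : groupType) (f : {multiplicative G -> H}).

Definition bar_map n : bar R G n -> bar R H n :=
  linext (fun t : n.-tuple G => << [tuple of map f t] >>).

HB.instance Definition _ n := GRing.Linear.on (@bar_map n).

Lemma bar_mapU n (t : n.-tuple G) :
  bar_map << t >> = << [tuple of map f t] >>.
Proof. by rewrite /bar_map linextU scale1r. Qed.

Lemma bar_face_map n i (t : n.+1.-tuple G) :
  bar_face i [tuple of map f t] = [tuple of map f (bar_face i t)].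
Proof.
apply: eq_from_tnth => j; rewrite [RHS]tnth_map /bar_face !tnth_mktuple !tnth_map.
by do 2?case: ifP => // _; rewrite gmulfM.
Qed.

Lemma bar_map_diff n (c : bar R G n.+1) :
  bar_map (bar_diff c) = bar_diff (bar_map c).
Proof.
apply: (@linext_ext _ _ _ (@bar_map n \o @bar_diff R G n)
                          (@bar_diff R H n \o @bar_map n.+1)) => t /=.
rewrite bar_mapU !bar_diffU linear_sum /=; apply: eq_bigr => i _.
by rewrite linearZ /= bar_mapU bar_face_map.
Qed.

Variable n : nat.

Lemma bar_map_cycle (c : bar R G n) :
  c \in bar_cycle R G n -> bar_map c \in bar_cycle R H n.
Proof.
case: n c => [|k] c; first by [].
by move=> /kernelP /= dc; apply/kernelP; rewrite /= -bar_map_diff dc linear0.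
Qed.

Definition cycles_map (z : bar_cycles R G n) : bar_cycles R H n :=
  exist _ (bar_map (val z)) (bar_map_cycle (valP z)).

Lemma cycles_map_is_zmod : zmod_morphism cycles_map.
Proof. by move=> x y; apply: val_inj; rewrite /= !raddfB. Qed.

HB.instance Definition _ := GRing.isZmodMorphism.Build _ _ cycles_map
  cycles_map_is_zmod.

Definition homology_map (x : homology R G n) : homology R H n :=
  hclass (cycles_map (repr x)).

Lemma homology_mapE z : homology_map (hclass z) = hclass (cycles_map z).
Proof.
apply/hclassP; rewrite -raddfB.
have /hclassP/asboolP [c zc] := hclass_repr (hclass z).
by apply/asboolP; exists (bar_map c); rewrite -bar_map_diff -zc.
Qed.

Lemma homology_map_is_zmod : zmod_morphism homology_map.
Proof.
move=> x y; rewrite -[x]hclass_repr -[y]hclass_repr.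
by move: (repr x) (repr y) => a b; rewrite -raddfB !homology_mapE !raddfB.
Qed.

HB.instance Definition _ := GRing.isZmodMorphism.Build _ _ homology_map
  homology_map_is_zmod.

End HomologyMap.

Arguments homology_map R {G H} f n.

Section Phi.
Variables (p m : nat) (B : groupType).

Definition Phi : {pred homology 'F_p B 2} :=
  kernel (homology_map 'F_p (pcentral_proj p B m) 2).

HB.instance Definition _ := GRing.ZmodClosed.on Phi.

Definition H2_mod_Phi : zmodType := Quotient.quot Phi.

Definition Phi_proj (x : homology 'F_p B 2) : H2_mod_Phi :=
  \pi_(Quotient.quot Phi) x.

Lemma Phi_proj_is_zmod : zmod_morphism Phi_proj.
Proof. exact: (pi_is_zmod_morphism (Quotient.quot Phi)). Qed.

HB.instance Definition _ := GRing.isZmodMorphism.Build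
  (homology 'F_p B 2) H2_mod_Phi Phi_proj Phi_proj_is_zmod.

Lemma Phi_proj_eq0 x : (Phi_proj x == 0) = (x \in Phi).
Proof. by rewrite -[x in RHS]subr0 Quotient.idealrBE -(raddf0 Phi_proj). Qed.

End Phi.

Arguments Phi : clear implicits.
Arguments Phi_proj p m B : clear implicits.

(* Main.v *)
From HB Require Import structures.
From mathcomp Require Import monalg.
Require Import Defs.
From mathcomp Require Import all_boot all_algebra.
From mathcomp Require Import boolp.

Set Implicit Arguments.
Unset Strict Implicit.
Unset Printing Implicit Defensive.

Import GRing.Theory.

Local Open Scope ring_scope.

(** The argument is Stallings' comparison of lower central quotients, by
    induction on [n], with the five-term exact sequence replaced by explicit
    low-degree bar chains. Write [K] for the 2-chains of [G] that die in
    [G/G_n], all indices being those of the p-lower central series. The sequence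
    enters through two facts about the 1-chain [x] - [1], for [x] in [G_n]:
    - if [x] lies in [G_(n+1)], then [x] - [1] is the boundary of an element of
      [K] ([lower_pcentral_boundary]): modulo boundaries of [K], the map
      [x |-> [x] - [1]] is additive on [G_n] and invariant under conjugation by
      [G], and its values are killed by [p], so it kills p-th powers and
      commutators;
    - conversely, if [x] - [1] is the boundary of an element of [K], then [x]
      lies in [G_(n+1)] ([eq_of_boundary]): the extension of [G/G_n] by the
      central elementary abelian group [G_n/G_(n+1)] is described by a 2-cocycle
      on [G/G_n] which becomes a coboundary on [G], and evaluating this
      coboundary on the boundary recovers the class of [x].

    Surjectivity of [A/A_n -> B/B_n] follows from surjectivity on [H_1]. Every
    1-chain is homologous to a single [[a]] ([chain_homologous]), so [A] maps
    onto [B/B_2]. Higher up, an element of [B_(n+1)] is a product of p-th powers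
    and commutators of elements which lift to [A] up to factors that are central
    of order dividing [p] modulo [B_(n+2)]; such factors change neither p-th
    powers nor commutators ([lower_pcentral_lift]).

    For injectivity, let [n <= m], let [A/A_n -> B/B_n] be injective, and let
    [phi a] lie in [B_(n+1)] ([lower_pcentral_reflect]). By injectivity on
    [H_1], [a] - [1] is the boundary of some [c]; by the first fact,
    [phi a] - [1] is the boundary of some [k] that dies in [B/B_n]. So
    [phi c - k] is a 2-cycle of [B], and the hypothesis on [H_2] gives a 2-cycle
    [x] of [A] such that [phi c - k - phi x] becomes a boundary in [B/B_m]. As
    [A] maps onto [B/B_m], that boundary comes from a 3-chain [e] of [A], and
    [c - x - d e] then dies in [B/B_n] because [n <= m], while its boundary is
    still [a] - [1]. The second fact, applied to the map from [A] to [B/B_n],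
    whose kernel is [A_n], shows that [a] lies in [A_(n+1)]. *)

(** * Central elements of order dividing p *)

Section CentralTorsion.
Variables (p : nat) (E : groupType).

(** The exponent is [#|'F_p|], which is [p] for prime [p], so that the module
    structure over ['F_p] below exists for every [p]. *)
Definition central_torsion : {pred E} :=
  fun x => `[< (x ^+ #|'F_p| = 1)%g /\ forall y, commute x y >].

Lemma central_torsionP x :
  reflect ((x ^+ #|'F_p| = 1)%g /\ forall y, commute x y)
          (x \in central_torsion).
Proof. exact: asboolP. Qed.

Lemma central_torsionC x y : x \in central_torsion -> commute x y.
Proof. by case/central_torsionP. Qed.

Lemma central_torsionX x : x \in central_torsion -> (x ^+ #|'F_p| = 1)%g.
Proof. by case/central_torsionP. Qed.

Lemma central_torsion1 : 1%g \in central_torsion.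
Proof.
apply/central_torsionP; split=> [|y]; first exact: expg1n.
exact/commute_sym/commute1.
Qed.

Lemma central_torsionM : mulg_closed central_torsion.
Proof.
move=> x y Vx Vy; apply/central_torsionP; split=> [|z].
  by rewrite expgMn ?central_torsionX ?mulg1 //; exact: central_torsionC.
by apply/commute_sym/commuteM; apply/commute_sym/central_torsionC.
Qed.

Lemma central_torsionV : invg_closed central_torsion.
Proof.
move=> x Vx; apply/central_torsionP; split=> [|z].
  by rewrite expVgn central_torsionX // invg1.
exact/commute_sym/commuteV/commute_sym/central_torsionC.
Qed.

(** The subgroup [Omega_1] of the centre for exponent [p]. It is made a type of
    its own, written additively, to serve as a coefficient module. *)
Definition omega : Type := {x : E | x \in central_torsion}.

HB.instance Definition _ := [isSub of omega for @sval _ _].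
HB.instance Definition _ := [Choice of omega by <:].

Definition omega_of x (Vx : x \in central_torsion) : omega := exist _ x Vx.

Definition omega0 : omega := omega_of central_torsion1.
Definition omega_add (u v : omega) : omega :=
  omega_of (central_torsionM (valP u) (valP v)).
Definition omega_opp (u : omega) : omega :=
  omega_of (central_torsionV (valP u)).

Lemma omega_addA : associative omega_add.
Proof. by move=> u v w; apply: val_inj; exact: mulgA. Qed.

Lemma omega_addC : commutative omega_add.
Proof. by move=> u v; apply: val_inj; exact/central_torsionC/valP. Qed.

Lemma omega_add0 : left_id omega0 omega_add.
Proof. by move=> u; apply: val_inj; exact: mul1g. Qed.

Lemma omega_addN : left_inverse omega0 omega_opp omega_add.
Proof. by move=> u; apply: val_inj; exact: mulVg. Qed.

HB.instance Definition _ := GRing.isZmodule.Build omega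
  omega_addA omega_addC omega_add0 omega_addN.

Lemma val_omegaD (u v : omega) : val (u + v) = (val u * val v)%g.
Proof. by []. Qed.

Lemma val_omegaN (u : omega) : val (- u) = (val u)^-1%g.
Proof. by []. Qed.

Lemma val_omegaMn (u : omega) n : val (u *+ n) = (val u ^+ n)%g.
Proof. by elim: n => // n IHn; rewrite mulrS expgS val_omegaD IHn. Qed.

Definition omega_scale (a : 'F_p) (u : omega) : omega := u *+ a.

Lemma omega_mod (u : omega) n : u *+ (n %% #|'F_p|) = u *+ n.
Proof.
apply: val_inj; rewrite !val_omegaMn [in RHS](divn_eq n #|'F_p|).
by rewrite expgnDr mulnC expgnA central_torsionX ?expg1n ?mul1g // (valP u).
Qed.

Lemma omega_scaleA a b u :
  omega_scale a (omega_scale b u) = omega_scale (a * b) u.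
Proof. by rewrite /omega_scale /= -mulrnA -[LHS]omega_mod card_ord mulnC. Qed.

Lemma omega_scale1 : left_id 1 omega_scale.
Proof. by []. Qed.

Lemma omega_scaleDr : right_distributive omega_scale +%R.
Proof. by move=> a u v; exact: mulrnDl. Qed.

Lemma omega_scaleDl u : {morph omega_scale^~ u : a b / a + b}.
Proof.
by move=> a b; rewrite /omega_scale /= -mulrnDr -[RHS]omega_mod card_ord.
Qed.

HB.instance Definition _ := GRing.Zmodule_isLmodule.Build 'F_p omega
  omega_scaleA omega_scale1 omega_scaleDr omega_scaleDl.

End CentralTorsion.

Arguments central_torsion : clear implicits.

(** * Bar chains in degrees one and two *)

(** Locked so that two bar simplices are compared by their entries, not as
    finitely supported functions. *)
HB.lock Definition bar1 (R : nzRingType) (G : groupType) (x : G) : bar R G 1 :=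
  << [tuple x] >>.
HB.lock Definition bar2 (R : nzRingType) (G : groupType) (x y : G) :
  bar R G 2 := << [tuple x; y] >>.

Arguments bar1 R {G} x.
Arguments bar2 R {G} x y.

Section LowDegreeBar.
Variables (R : nzRingType) (G : groupType).

Local Notation bar1 := (@bar1 R G).
Local Notation bar2 := (@bar2 R G).

Lemma tuple1E (t : 1.-tuple G) : t = [tuple nth 1%g t 0].
Proof. by case/tupleP: t => x t; rewrite [t]tuple0; apply: val_inj. Qed.

Lemma bar1E (t : 1.-tuple G) : << t >> = bar1 (nth 1%g t 0) :> bar R G 1.
Proof. by rewrite unlock {1}(tuple1E t). Qed.

Lemma bar2E (t : 2.-tuple G) :
  << t >> = bar2 (nth 1%g t 0) (nth 1%g t 1) :> bar R G 2.
Proof.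
rewrite unlock; congr << _ >>; case/tupleP: t => x t; case/tupleP: t => y t.
by rewrite [t]tuple0; apply: val_inj.
Qed.

Lemma bar_diff2 x y : bar_diff (bar2 x y) = bar1 y - bar1 (x * y)%g + bar1 x.
Proof.
rewrite !unlock bar_diffU !big_ord_recl big_ord0 /=.
rewrite expr0 scale1r expr1 scaleN1r.
rewrite [bump 0 _]/= sqrrN expr1n scale1r addr0 addrA.
rewrite [bar_face 0 _]tuple1E [bar_face 1 _]tuple1E [bar_face 2 _]tuple1E.
by rewrite !bar_face_nth.
Qed.

Lemma bar_diff1 (c : bar R G 1) : bar_diff c = 0.
Proof.
apply: (@linext_ext _ _ _ (@bar_diff R G 0)
  (\0 : bar R G 1 -> bar R G 0)) => t /=.
rewrite bar_diffU !big_ord_recl big_ord0 /= expr0 scale1r expr1 scaleN1r addr0.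
by rewrite [bar_face 0 t]tuple0 [bar_face 1 t]tuple0 subrr.
Qed.

Lemma linear1_ext (V : lmodType R) (F F' : {linear bar R G 1 -> V}) :
  (forall x, F (bar1 x) = F' (bar1 x)) -> F =1 F'.
Proof. by move=> FF'; apply: linext_ext => t; rewrite bar1E. Qed.

Lemma linear2_ext (V : lmodType R) (F F' : {linear bar R G 2 -> V}) :
  (forall x y, F (bar2 x y) = F' (bar2 x y)) -> F =1 F'.
Proof. by move=> FF'; apply: linext_ext => t; rewrite bar2E. Qed.

Lemma linear_bar_diff2 (V : lmodType R) (F : {linear bar R G 1 -> V}) x y :
  F (bar_diff (bar2 x y)) = F (bar1 y) - F (bar1 (x * y)%g) + F (bar1 x).
Proof. by rewrite bar_diff2 raddfD raddfB. Qed.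

Lemma exists_linear1 (V : lmodType R) (u : G -> V) :
  exists F : {linear bar R G 1 -> V}, forall x, F (bar1 x) = u x.
Proof.
exists (linext (fun t : 1.-tuple G => u (nth 1%g t 0))) => x.
by rewrite unlock [LHS]linextU scale1r.
Qed.

Lemma exists_linear2 (V : lmodType R) (u : G -> G -> V) :
  exists F : {linear bar R G 2 -> V}, forall x y, F (bar2 x y) = u x y.
Proof.
exists (linext (fun t : 2.-tuple G => u (nth 1%g t 0) (nth 1%g t 1))) => x y.
by rewrite unlock [LHS]linextU scale1r.
Qed.

End LowDegreeBar.

Lemma bar_map1 (R : nzRingType) (G H : groupType)
    (f : {multiplicative G -> H}) x :
  bar_map f (bar1 R x) = bar1 R (f x).
Proof. by rewrite !unlock bar_mapU; congr << _ >>; apply: val_inj. Qed.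

Lemma bar_map2 (R : nzRingType) (G H : groupType)
    (f : {multiplicative G -> H}) x y :
  bar_map f (bar2 R x y) = bar2 R (f x) (f y).
Proof. by rewrite !unlock bar_mapU; congr << _ >>; apply: val_inj. Qed.

(** * Chains along a homomorphism *)

Section Factorization.
Variables (G H : groupType) (f : {multiplicative G -> H}).

Lemma exists_section : exists s : H -> G, forall x, f (s (f x)) = f x.
Proof.
suff [s sP] : {s : H -> G & forall q x, f x = q -> f (s q) = q}.
  by exists s => x; exact: sP.
apply: (@choice _ _ (fun q y => forall x, f x = q -> f y = q)) => q.
have [[x xq]|nq] := pselect (exists x, f x = q); first by exists x.
by exists 1%g => x xq; case: nq; exists x.
Qed.

Lemma exists_factor (T : Type) (u : G -> T) :
  (forall x y, f x = f y -> u x = u y) ->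
  exists v : H -> T, forall x, v (f x) = u x.
Proof.
move=> fu; have [s fsf] := exists_section.
by exists (u \o s) => x; exact: fu.
Qed.

Variables (R : nzRingType) (n : nat).

(** The map that [g] induces factors through the one that [f] induces: a factor
    of [g] through [f] as a map of sets already acts on bar chains in each
    degree. *)
Lemma bar_map_ker_sub (K : groupType) (g : {multiplicative G -> K})
    (c : bar R G n) :
  (forall x y, f x = f y -> g x = g y) -> bar_map f c = 0 -> bar_map g c = 0.
Proof.
move=> /exists_factor [v vf] fc0.
pose V : {linear bar R H n -> bar R K n} :=
  linext (fun t : n.-tuple H => << [tuple of map v t] >>).
have /(_ c) /= -> : @bar_map R G K g n =1 V \o @bar_map R G H f n.
  apply: linext_ext => t /=; rewrite !bar_mapU [V _]linextU scale1r.
  by congr << _ >>; apply: eq_from_tnth => i; rewrite !tnth_map vf.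
by rewrite fc0 linear0.
Qed.

Lemma bar_map_surj : (forall y, exists x, f x = y) ->
  forall d : bar R H n, exists c : bar R G n, bar_map f c = d.
Proof.
move=> /choice [s sK] d.
exists (linext (fun t : n.-tuple H => << [tuple of map s t] >> : bar R G n) d).
pose S : {linear bar R H n -> bar R G n} :=
  linext (fun t : n.-tuple H => << [tuple of map s t] >>).
suff /(_ d) : @bar_map R G H f n \o S =1 idfun by [].
apply: linext_ext => t /=; rewrite [S _]linextU scale1r bar_mapU.
by congr << _ >>; apply: eq_from_tnth => i; rewrite !tnth_map sK.
Qed.

End Factorization.

Lemma bar_map_comp (R : nzRingType) (G H K : groupType)
    (f : {multiplicative G -> H}) (g : {multiplicative H -> K}) n
    (c : bar R G n) :
  bar_map (g \o f) c = bar_map g (bar_map f c).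
Proof.
apply: (@linext_ext _ _ _ (@bar_map R G K (g \o f) n)
  (@bar_map R H K g n \o @bar_map R G H f n)) => t /=.
rewrite !bar_mapU; congr << _ >>; apply: eq_from_tnth => i.
by rewrite !tnth_map.
Qed.

(** * Detecting elements by boundaries *)

(** A 1-cochain whose coboundary is pulled back along [f] vanishes on the
    boundaries of the chains that [f] kills. *)
Lemma eq_of_boundary_coboundary (R : nzRingType) (G Q : groupType)
    (V : lmodType R) (f : {multiplicative G -> Q}) (h : G -> V)
    (u : Q -> Q -> V) (c : bar R G 2) v w :
  (forall x y, h y - h (x * y)%g + h x = u (f x) (f y)) ->
  bar_map f c = 0 -> bar_diff c = bar1 R v - bar1 R w -> h v = h w.
Proof.
move=> hu fc0 dc.
have [H HE] := exists_linear1 h; have [U UE] := exists_linear2 u.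
have HU : H \o @bar_diff R G 1 =1 U \o @bar_map R G Q f 2.
  apply: linear2_ext => x y /=.
  by rewrite bar_map2 UE linear_bar_diff2 (HE x) (HE y) (HE (x * y)%g) hu.
have := HU c; rewrite /= fc0 dc.
rewrite raddf0 raddfB /= (HE v) (HE w) => /eqP.
by rewrite subr_eq0 => /eqP.
Qed.

Section Detection.
Variables (p : nat) (G Q E : groupType).
Variables (f : {multiplicative G -> Q}) (g : {multiplicative G -> E}).
Hypothesis gker : forall x, f x = 1%g -> g x \in central_torsion p E.

(** For two lifts [X] and [Y] to [E] of elements of the quotient, and the lift
    [s] of their product, the cocycle value does not see central factors. *)
Lemma central_cocycle (a b X Y s : E) :
  a \in central_torsion p E -> b \in central_torsion p E ->
  (b * (a * X * (b * Y) * s^-1)^-1 * a = (X * Y * s^-1)^-1)%g.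
Proof.
move=> Va Vb.
have -> : (a * X * (b * Y) * s^-1 = a * (b * (X * Y * s^-1)))%g.
  by rewrite -!mulgA [(b * (X * _))%g]mulgA (central_torsionC X Vb) !mulgA.
move: (X * Y * s^-1)%g => W.
by rewrite !invgM !mulgA (central_torsionC W^-1%g Vb) mulgK mulgVK.
Qed.

(** Stallings' exact sequence at the kernel of [f]: a set-theoretic section [s]
    of [f] gives the 1-cochain [x |-> g x / g (s (f x))], which is valued in the
    central torsion of [E], has the same value at [v] and [w] only if [g] does
    (as [f v = f w]), and has as coboundary the pullback of the cocycle of the
    extension. *)
Lemma eq_of_boundary (c : bar 'F_p G 2) v w : bar_map f c = 0 ->
  bar_diff c = bar1 'F_p v - bar1 'F_p w -> f v = f w -> g v = g w.
Proof.
move=> fc0 dc fvw.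
have [s fsf] := exists_section f.
have hV x : (g x * (g (s (f x)))^-1)%g \in central_torsion p E.
  by rewrite -gmul_fV -gmulfM gker // gmulfM gmul_fV fsf mulgV.
pose h x := omega_of (hV x).
pose u q r : omega p E := h (s r) - h (s q * s r)%g + h (s q).
have hu x y : h y - h (x * y)%g + h x = u (f x) (f y).
  apply: val_inj; rewrite !val_omegaD !val_omegaN /=.
  rewrite !fsf !mulgV mul1g mulg1 !gmulfM !fsf.
  have gE z : g z = (g z * (g (s (f z)))^-1 * g (s (f z)))%g by rewrite mulgVK.
  rewrite -[RHS](central_cocycle _ _ _ (hV x) (hV y)).
  by rewrite -(gE x) -(gE y).
have /(congr1 val) /= := eq_of_boundary_coboundary hu fc0 dc.
rewrite fvw; exact: mulIg.
Qed.

End Detection.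

(** * One-chains modulo boundaries *)

(** The quotient of the 1-chains by the boundaries of the 2-chains that [F]
    kills. For [F = bar_map f] these are the chains that die in the target of
    [f]; for [F = 0] the quotient is [H_1]. *)
Section BoundaryQuotient.
Variables (R : nzRingType) (G : groupType) (W : zmodType).
Variable F : {additive bar R G 2 -> W}.

Definition ker_boundary : {pred bar R G 1} :=
  fun w => `[< exists2 k, F k = 0 & bar_diff k = w >].

Lemma ker_boundary_zmod_closed : zmod_closed ker_boundary.
Proof.
split=> [|v w /asboolP [k Fk dk] /asboolP [l Fl dl]]; apply/asboolP.
  by exists 0; [exact: raddf0 | exact: linear0].
by exists (k - l); [rewrite raddfB Fk Fl subr0 | rewrite linearB /= dk dl].
Qed.

HB.instance Definition _ := GRing.isZmodClosed.Build (bar R G 1) ker_boundary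
  ker_boundary_zmod_closed.

Definition bquot : zmodType := Quotient.quot ker_boundary.

Definition bclass (w : bar R G 1) : bquot :=
  \pi_(Quotient.quot ker_boundary)%qT w.

Lemma bclass_is_zmod : zmod_morphism bclass.
Proof. exact: (pi_is_zmod_morphism (Quotient.quot ker_boundary)). Qed.

HB.instance Definition _ :=
  GRing.isZmodMorphism.Build (bar R G 1) bquot bclass bclass_is_zmod.

Lemma bclass_eq0 w : bclass w = 0 <-> exists2 k, F k = 0 & bar_diff k = w.
Proof.
rewrite -(raddf0 bclass); split=> [/eqP|wk].
  by rewrite -Quotient.idealrBE subr0 => /asboolP.
by apply/eqP; rewrite -Quotient.idealrBE subr0; apply/asboolP.
Qed.

End BoundaryQuotient.

Section RelativeClass.
Variables (R : nzRingType) (G Q : groupType) (f : {multiplicative G -> Q}).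

Local Notation cl := (bclass (@bar_map R G Q f 2)).

Definition rclass (x : G) : bquot (@bar_map R G Q f 2) :=
  cl (bar1 R x) - cl (bar1 R 1%g).

(** If [f x = 1], the bar simplices [[1|y]] and [[x|y]] have the same image, and
    the boundary of their difference is the relation; if [f y = 1], the same
    holds for [[x|1]] and [[x|y]]. *)
Lemma rclassM x y : f x = 1%g \/ f y = 1%g ->
  rclass (x * y)%g = rclass x + rclass y.
Proof.
move=> fxy; rewrite /rclass addrACA -opprD.
suff <- : cl (bar1 R (x * y)%g) + cl (bar1 R 1%g)
          = cl (bar1 R x) + cl (bar1 R y).
  by rewrite opprD addrA addrK.
apply/eqP; rewrite -subr_eq0 -!raddfD -raddfB; apply/eqP/bclass_eq0.
rewrite [bar1 R (x * y)%g + _]addrC.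
have dE (a b c d : bar R G 1) : d - (b - c + a) = d + c - (a + b).
  rewrite [a + b]addrC !opprD opprK !addrA; congr (_ - _).
  exact: addrAC.
case: fxy => [fx|fy].
- exists (bar2 R 1%g y - bar2 R x y).
    by rewrite raddfB /= !bar_map2 fx gmul_f1 subrr.
  by rewrite linearB /= !bar_diff2 mul1g subrr add0r dE.
- exists (bar2 R x 1%g - bar2 R x y).
    by rewrite raddfB /= !bar_map2 fy gmul_f1 subrr.
  by rewrite linearB /= !bar_diff2 mulg1 subrK dE.
Qed.

Lemma rclass1 : rclass 1%g = 0.
Proof. exact: subrr. Qed.

Lemma rclassV x : f x = 1%g -> rclass x^-1%g = - rclass x.
Proof.
move=> fx; apply/eqP; rewrite -addr_eq0 -rclassM ?mulVg ?rclass1 //; by right.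
Qed.

Lemma rclassX x n : f x = 1%g -> rclass (x ^+ n)%g = rclass x *+ n.
Proof.
move=> fx; elim: n => [|n IHn]; first exact: rclass1.
by rewrite expgS mulrS rclassM ?IHn; last left.
Qed.

(** Expanding both sides of [x y = (y x) [~ x, y]] by additivity gives the same
    two terms. *)
Lemma rclassR x y : f x = 1%g -> rclass [~ x, y]%g = 0.
Proof.
move=> fx; have fR : f [~ x, y]%g = 1%g by rewrite gmul_fR fx comm1g.
apply: (addrI (rclass (y * x)%g)); rewrite addr0 -rclassM; last by right.
rewrite -commgC (rclassM (or_introl fx)) (rclassM (or_intror fx)); exact: addrC.
Qed.

End RelativeClass.

(** * The p-lower central series *)

Lemma gen_ind (G : groupType) (S P : G -> Prop) :
  P 1%g -> (forall x y, P x -> P y -> P (x * y)%g) ->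
  (forall x, P x -> P x^-1%g) -> (forall x, S x -> P x) ->
  forall x, x \in gen S -> P x.
Proof.
move=> P1 PM PV SP x.
pose A : {pred G} := fun x => `[< P x >].
have AM : mulg_closed A.
  by move=> y z /asboolP Py /asboolP Pz; apply/asboolP; exact: PM.
have A1 : 1%g \in A by exact/asboolP.
have AV : invg_closed A by move=> y /asboolP Py; apply/asboolP; exact: PV.
pose K : groupClosed G := HB.pack A (isMulClosed.Build G A AM)
  (isMul1Closed.Build G A A1) (isInvClosed.Build G A AV).
by move=> /genP /(_ K) xK; apply/asboolP/xK => s /SP Ps; exact/asboolP.
Qed.

Section LowerPCentralLemmas.
Variables (p : nat) (G : groupType).
Local Notation pi := (pcentral_proj p G).

Lemma pcentral_projP n x y :
  pi n x = pi n y <-> (x^-1 * y)%g \in lower_pcentral p G n.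
Proof. by split=> /gprojP. Qed.

Lemma pcentral_proj_eq1 n x : pi n x = 1%g <-> x \in lower_pcentral p G n.
Proof.
rewrite -(gmul_f1 (pi n)) -[X in X \in _]mul1g -[X in (X * x)%g]invg1.
by rewrite -pcentral_projP; split=> /esym.
Qed.

Lemma pcentral_proj_trivial x y : pi 1 x = pi 1 y.
Proof. exact/pcentral_projP. Qed.

Lemma lower_pcentral_ind n (P : G -> Prop) :
  P 1%g -> (forall x y, P x -> P y -> P (x * y)%g) ->
  (forall x, P x -> P x^-1%g) ->
  (forall x, x \in lower_pcentral p G n.+1 -> P (x ^+ p)%g) ->
  (forall x y, x \in lower_pcentral p G n.+1 -> P [~ x, y]%g) ->
  forall x, x \in lower_pcentral p G n.+2 -> P x.
Proof.
move=> P1 PM PV PX PR; apply: gen_ind => // z [[x xG ->]|[x xG [y ->]]].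
  exact: PX.
exact: PR.
Qed.

Lemma lower_pcentral_step n x :
  x \in lower_pcentral p G n.+2 -> x \in lower_pcentral p G n.+1.
Proof.
move: x; apply: lower_pcentral_ind => [|x y|x|x xG|x y xG].
- exact: gpred1.
- exact: gpredM.
- by rewrite gpredV.
- exact: gpredXn.
- by rewrite commgEl gpredM ?gpredV ?gpredJr.
Qed.

Lemma lower_pcentral_sub m n x : (1 <= m <= n)%N ->
  x \in lower_pcentral p G n -> x \in lower_pcentral p G m.
Proof.
case: m => //= m mn; elim: n mn => // n IHn.
rewrite ltnS leq_eqVlt => /orP [/eqP -> //|mn]; case: n IHn mn => // n IHn mn.
by move=> /lower_pcentral_step; exact: IHn.
Qed.

Lemma pcentral_proj_sub m n x y : (1 <= m <= n)%N ->
  pi n x = pi n y -> pi m x = pi m y.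
Proof.
by move=> mn /pcentral_projP xy; apply/pcentral_projP/(lower_pcentral_sub mn).
Qed.

Hypothesis p_prime : prime p.

Lemma pcentral_proj_central n x : x \in lower_pcentral p G n.+1 ->
  pi n.+2 x \in central_torsion p (pcentral_quot p G n.+2).
Proof.
move=> xG; apply/central_torsionP; rewrite card_Fp //; split=> [|q].
  by rewrite -gmul_fX; apply/pcentral_proj_eq1/sub_gen; left; exists x.
rewrite -[q]gproj_repr; set y := repr q.
apply/commgP; rewrite -[gproj _ y]/(pi n.+2 y) -gmul_fR; apply/eqP.
by apply/pcentral_proj_eq1/sub_gen; right; exists x => //; exists y.
Qed.

Lemma bar_Fp_torsion n (c : bar 'F_p G n) : c *+ p = 0.
Proof. by rewrite -scaler_nat pchar_Fp_0 // scale0r. Qed.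

Lemma lower_pcentral_boundary n x : x \in lower_pcentral p G n.+2 ->
  exists2 k, bar_map (pi n.+1) k = 0 & bar_diff k = bar1 'F_p x - bar1 'F_p 1%g.
Proof.
move=> xG; apply/bclass_eq0; rewrite raddfB -/(rclass _ _ x) /=.
suff [] : pi n.+1 x = 1%g /\ rclass 'F_p (pi n.+1) x = 0 by [].
move: x xG; apply: lower_pcentral_ind => [|x y [px rx] [py ry]|x [px rx]|x|x y].
- by rewrite gmul_f1 rclass1.
- by rewrite gmulfM px py mulg1 rclassM ?rx ?ry ?addr0 //; left.
- by rewrite gmul_fV px invg1 rclassV // rx oppr0.
- move=> /pcentral_proj_eq1 px.
  rewrite gmul_fX px expg1n rclassX //; split=> //.
  by rewrite /rclass -raddfB -raddfMn bar_Fp_torsion raddf0.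
- move=> /pcentral_proj_eq1 px.
  by rewrite gmul_fR px comm1g rclassR.
Qed.

(** The detection principle for the trivial quotient [G/G_1], where [c] dies
    automatically: the only 2-simplex has the only 1-simplex as boundary, so the
    image of [c] is determined by that of [bar_diff c], whose coefficients add
    up to zero. *)
Lemma eq_proj2_of_boundary (c : bar 'F_p G 2) x y :
  bar_diff c = bar1 'F_p x - bar1 'F_p y -> pi 2 x = pi 2 y.
Proof.
move=> dc; apply: (@eq_of_boundary p _ _ _ (pi 1) (pi 2) _ c) => //.
- by move=> z _; exact: pcentral_proj_central.
- pose q : bar 'F_p _ 2 := bar2 'F_p (pi 1 x) (pi 1 x).
  have [T TE] := exists_linear1 (fun _ : G => q).
  have /(_ c) /= -> : @bar_map 'F_p G _ (pi 1) 2 =1 T \o @bar_diff 'F_p G 1.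
    apply: linear2_ext => z w /=; rewrite bar_map2 linear_bar_diff2.
    rewrite !TE subrr add0r /q.
    by congr bar2; exact: pcentral_proj_trivial.
  by rewrite dc raddfB /= !TE subrr.
- exact: pcentral_proj_trivial.
Qed.

Local Notation cl := (bclass (\0 : bar 'F_p G 2 -> bar 'F_p G 2)).

(** In [H_1] sums of group elements are products, and a coefficient in ['F_p] is
    the image of a natural number. *)
Lemma chain_homologous (w : bar 'F_p G 1) :
  exists a c, bar_diff c = w - bar1 'F_p a.
Proof.
have clM x y : cl (bar1 'F_p (x * y)%g) = cl (bar1 'F_p x) + cl (bar1 'F_p y).
  apply/esym/eqP; rewrite -subr_eq0 -raddfD -raddfB; apply/eqP/bclass_eq0.
  exists (bar2 'F_p x y) => //.
  by rewrite bar_diff2 addrAC [bar1 _ y + _]addrC.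
suff [a wa] : exists a, cl w = cl (bar1 'F_p a).
  exists a; have /bclass_eq0 [c _ dc] : cl (w - bar1 'F_p a) = 0.
    by rewrite raddfB /= wa subrr.
  by exists c.
have cl1 : cl (bar1 'F_p 1%g) = 0.
  by apply: (addrI (cl (bar1 'F_p 1%g))); rewrite -clM mulg1 addr0.
have clX x n : cl (bar1 'F_p (x ^+ n)%g) = cl (bar1 'F_p x) *+ n.
  by elim: n => [|n IHn]; rewrite ?cl1 // expgS mulrS clM IHn.
rewrite [w]monalgE; elim/big_ind: _ => [|u v [a ua] [b vb]|t _].
- by exists 1%g; rewrite cl1 raddf0.
- by exists (a * b)%g; rewrite raddfD /= ua vb clM.
- exists (nth 1%g t 0 ^+ w@_t)%g; rewrite clX -bar1E -raddfMn /=.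
  by rewrite -scaler_nat malgZU mulr1 natr_Zp.
Qed.

End LowerPCentralLemmas.

(** * The homological hypotheses in terms of chains *)

Section HomologyClasses.
Variables (R : nzRingType) (G : groupType).

Lemma hclass_eq0 n (z : bar_cycles R G n) :
  hclass z = 0 <-> exists c, val z = bar_diff c.
Proof.
rewrite -(raddf0 (@hclass R G n)); split=> [/hclassP|zc].
  by rewrite subr0 => /asboolP.
by apply/hclassP; rewrite subr0; apply/asboolP.
Qed.

Lemma chain1_cycle (c : bar R G 1) : c \in bar_cycle R G 1.
Proof. exact/kernelP/bar_diff1. Qed.

Definition cycle1 (c : bar R G 1) : bar_cycles R G 1 :=
  exist _ c (chain1_cycle c).

Definition cycle2 (c : bar R G 2) (dc : bar_diff c = 0) : bar_cycles R G 2 :=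
  exist _ c (introT (kernelP _ _) dc).

End HomologyClasses.

Section ChainLevel.
Variables (R : nzRingType) (G H : groupType) (f : {multiplicative G -> H}).

Lemma H1_inj_chain : injective (homology_map R f 1) ->
  forall c d, bar_map f c = bar_diff d -> exists e, bar_diff e = c :> bar R G 1.
Proof.
move=> finj c d fcd.
suff /hclass_eq0 [e ce] : hclass (cycle1 c) = 0 by exists e; exact/esym.
apply: finj; rewrite homology_mapE raddf0; apply/hclass_eq0.
by exists d.
Qed.

Lemma H1_surj_chain : (forall y, exists x, homology_map R f 1 x = y) ->
  forall d, exists c e, d - bar_map f c = bar_diff e :> bar R H 1.
Proof.
move=> fsurj d; have [x xd] := fsurj (hclass (cycle1 d)).
exists (val (repr x)).
suff /hclass_eq0 [e de] : hclass (cycle1 d - cycles_map f (repr x)) = 0.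
  by exists e.
by rewrite raddfB /= -homology_mapE hclass_repr xd subrr.
Qed.

End ChainLevel.

Lemma H2_epi_chain (p m : nat) (A B : groupType)
    (phi : {multiplicative A -> B}) :
  (forall y : H2_mod_Phi p m B,
     exists x : homology 'F_p A 2,
       Phi_proj p m B (homology_map 'F_p phi 2 x) = y) ->
  forall z : bar 'F_p B 2, bar_diff z = 0 ->
  exists2 x : bar 'F_p A 2, bar_diff x = 0 &
    exists e, bar_map (pcentral_proj p B m) (z - bar_map phi x) = bar_diff e.
Proof.
move=> epi z dz; have [x xz] := epi (Phi_proj p m B (hclass (cycle2 dz))).
exists (val (repr x)); first exact/kernelP/(valP (repr x)).
have /eqP : Phi_proj p m B (hclass (cycle2 dz - cycles_map phi (repr x))) = 0.
  by rewrite !raddfB /= -homology_mapE hclass_repr xz subrr.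
by rewrite Phi_proj_eq0 => /kernelP /=; rewrite homology_mapE => /hclass_eq0.
Qed.

Lemma raddf_sub_shift (U V : zmodType) (F : {additive U -> V}) c x d k :
  F (c - x - d) - k = F c - k - F x - F d.
Proof. by rewrite !raddfB addrAC; congr (_ - _); exact: addrAC. Qed.

(** * Surjectivity *)

Section CentralExtension.
Variables (p : nat) (E : groupType).

Lemma expg_central (u x : E) : prime p -> u \in central_torsion p E ->
  ((x * u) ^+ p = x ^+ p)%g.
Proof.
move=> /card_Fp oF Vu; rewrite -oF expgMn ?(central_torsionX Vu) ?mulg1 //.
exact/commute_sym/(central_torsionC x Vu).
Qed.

Lemma commg_central (u v x y : E) :
  u \in central_torsion p E -> v \in central_torsion p E ->
  ([~ x * u, y * v] = [~ x, y])%g.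
Proof.
move=> Vu Vv; apply: (mulgI ((y * v) * (x * u))%g); rewrite -commgC.
have -> : (y * v * (x * u) = y * x * (u * v))%g.
  by rewrite -!mulgA; congr (_ * _)%g; rewrite (central_torsionC _ Vv) -!mulgA.
have Vuv := central_torsionM Vu Vv.
rewrite -[RHS]mulgA (central_torsionC _ Vuv) [RHS]mulgA -commgC -!mulgA.
by congr (_ * _)%g; rewrite [LHS]mulgA (central_torsionC y Vu) mulgA.
Qed.

End CentralExtension.

Section PCentralMapping.
Variables (p : nat) (A B : groupType) (phi : {multiplicative A -> B}).
Hypothesis p_prime : prime p.

Local Notation piA := (pcentral_proj p A).
Local Notation piB := (pcentral_proj p B).

Lemma eq_pcentral_mul n b b' : piB n b = piB n b' ->
  exists2 u, u \in lower_pcentral p B n & b = (b' * u)%g.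
Proof.
by move=> /esym/pcentral_projP bb'; exists (b'^-1 * b)%g; rewrite ?mulVKg.
Qed.

(** Both statements are needed at once: a generator [[~ x, y]] of the next term
    has [x] in the previous term, lifted inside that term, but [y] in all of
    [B]. *)
Lemma lower_pcentral_lift :
  (forall b, exists a, piB 2 b = piB 2 (phi a)) -> forall n,
  (forall b, exists a, piB n.+1 b = piB n.+1 (phi a)) /\
  (forall b, b \in lower_pcentral p B n.+1 ->
   exists2 a, a \in lower_pcentral p A n.+1 & piB n.+2 b = piB n.+2 (phi a)).
Proof.
move=> lift2; elim=> [|n [IHs IHl]].
  split=> [b|b _]; first by exists 1%g; exact: pcentral_proj_trivial.
  by have [a ba] := lift2 b; exists a.
have lift_elt b : exists a, piB n.+2 b = piB n.+2 (phi a).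
  have [a /eq_pcentral_mul [u uB ->]] := IHs b.
  have [a' _ ua'] := IHl u uB.
  by exists (a * a')%g; rewrite !gmulfM ua'.
split=> //; apply: lower_pcentral_ind => [|x y [a aA xa] [b bA yb]|x [a aA xa]
  |x xB|x y xB].
- by exists 1%g; [exact: gpred1 | rewrite !gmul_f1].
- by exists (a * b)%g; [exact: gpredM | rewrite !gmulfM xa yb].
- by exists a^-1%g; [rewrite gpredV | rewrite !gmul_fV xa].
- have [a aA /eq_pcentral_mul [u uB ->]] := IHl x xB.
  exists (a ^+ p)%g; first by apply: sub_gen; left; exists a.
  rewrite !gmul_fX gmulfM (expg_central _ p_prime) //.
  exact: pcentral_proj_central.
- have [a aA /eq_pcentral_mul [u uB ->]] := IHl x xB.
  have [b /eq_pcentral_mul [v vB ->]] := lift_elt y.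
  exists [~ a, b]%g; first by apply: sub_gen; right; exists a => //; exists b.
  by rewrite !gmul_fR !gmulfM (commg_central (p := p)) //;
    exact: pcentral_proj_central.
Qed.

Lemma pcentral_proj_lift :
  (forall y, exists x, homology_map 'F_p phi 1 x = y) ->
  forall n b, exists a, piB n.+1 b = piB n.+1 (phi a).
Proof.
move=> H1_surj n; apply: (lower_pcentral_lift _ n).1 => b.
have [w [e de]] := H1_surj_chain H1_surj (bar1 'F_p b).
have [a [c dc]] := chain_homologous w.
exists a; apply: (@eq_proj2_of_boundary p _ p_prime (e + bar_map phi c)).
by rewrite raddfD /= -de -bar_map_diff dc raddfB /= bar_map1 addrA subrK.
Qed.

(** * Injectivity *)

Lemma lower_pcentral_reflect (m n : nat) : (1 <= n <= m)%N ->
  injective (homology_map 'F_p phi 1) ->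
  (forall y, exists x, homology_map 'F_p phi 1 x = y) ->
  (forall y : H2_mod_Phi p m B,
     exists x : homology 'F_p A 2,
       Phi_proj p m B (homology_map 'F_p phi 2 x) = y) ->
  (forall a, phi a \in lower_pcentral p B n -> a \in lower_pcentral p A n) ->
  forall a, phi a \in lower_pcentral p B n.+1 -> a \in lower_pcentral p A n.+1.
Proof.
case: n => // n; case: m => // m nm H1_inj H1_surj H2_epi IHn a aB.
have [k pk dk] := lower_pcentral_boundary p_prime aB.
have [|c dc] := H1_inj_chain H1_inj (c := bar1 'F_p a - bar1 'F_p 1%g) (d := k).
  by rewrite dk raddfB /= !bar_map1 gmul_f1.
have dz : bar_diff (bar_map phi c - k) = 0.
  by rewrite raddfB /= -bar_map_diff dc dk raddfB /= !bar_map1 gmul_f1 subrr.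
have [x dx [e de]] := H2_epi_chain H2_epi dz.
pose fm : {multiplicative A -> pcentral_quot p B m.+1} := piB m.+1 \o phi.
pose fn : {multiplicative A -> pcentral_quot p B n.+1} := piB n.+1 \o phi.
have fm_surj q : exists a0, fm a0 = q.
  have [a0 qa0] := pcentral_proj_lift H1_surj m (repr q).
  by exists a0; rewrite -[RHS]gproj_repr; exact/esym.
have [e' fe'] := bar_map_surj fm_surj e.
(* Same boundary as [c], but corrected so as to die in B/B_n. *)
pose c' := c - x - bar_diff e'.
have dc' : bar_diff c' = bar1 'F_p a - bar1 'F_p 1%g.
  by rewrite !raddfB /= bar_diff_diff dx !subr0 dc.
have fc' : bar_map fn c' = 0.
  have c'E : bar_map phi c' - k =
      bar_map phi c - k - bar_map phi x - bar_map phi (bar_diff e').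
    exact: (raddf_sub_shift (@bar_map _ _ _ phi 2)).
  have pe' : bar_map (piB m.+1) (bar_map phi (bar_diff e')) = bar_diff e.
    by rewrite -bar_map_comp bar_map_diff fe'.
  have pc' : bar_map (piB m.+1) (bar_map phi c' - k) = 0.
    by rewrite c'E raddfB /= de pe' subrr.
  have : bar_map (piB n.+1) (bar_map phi c' - k) = 0.
    by apply: bar_map_ker_sub pc' => u v; exact: pcentral_proj_sub.
  by rewrite raddfB /= pk subr0 -bar_map_comp.
apply/pcentral_proj_eq1; rewrite -(gmul_f1 (piA n.+2)).
apply: (@eq_of_boundary p _ _ _ fn (piA n.+2) _ c') => //.
- by move=> v /pcentral_proj_eq1 /IHn; exact: pcentral_proj_central.
- rewrite gmul_f1; apply/pcentral_proj_eq1; exact: lower_pcentral_step.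
Qed.

End PCentralMapping.

Lemma bijective_of_inj_surj (T U : Type) (f : T -> U) :
  injective f -> (forall y, exists x, f x = y) -> bijective f.
Proof. by move=> finj /choice [g gK]; exists g => // x; apply: finj. Qed.

Theorem theorem3p2 (p m : nat) (p_prime : prime p) (m_ge1 : (1 <= m)%N)
  (A B : groupType) (phi : {multiplicative A -> B})
  (H1_iso : bijective (homology_map 'F_p phi 1))
  (H2_epi : forall y : H2_mod_Phi p m B,
     exists x : homology 'F_p A 2, Phi_proj p m B (homology_map 'F_p phi 2 x) = y)
  (n : nat) (n_ge1 : (1 <= n)%N) (n_le : (n <= m + 1)%N) :
  bijective (pcentral_map p phi n).
Proof.
have H1_inj := bij_inj H1_iso.
have H1_surj y : exists x, homology_map 'F_p phi 1 x = y.
  by have [g _ gK] := H1_iso; exists (g y).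
case: n n_ge1 n_le => // n _; rewrite addn1 ltnS => nm.
have reflect a : phi a \in lower_pcentral p B n.+1 ->
    a \in lower_pcentral p A n.+1.
  elim: n nm a => [//|n IHn] nm.
  have {}IHn := IHn (ltnW nm).
  exact: (lower_pcentral_reflect p_prime (m := m) _ H1_inj H1_surj H2_epi IHn).
apply: bijective_of_inj_surj => [q r|q].
  rewrite -[q]gproj_repr -[r]gproj_repr.
  rewrite -!/(pcentral_proj p A n.+1 _) !pcentral_mapE => /pcentral_projP.
  by rewrite -gmul_fV -gmulfM => /reflect /pcentral_projP.
have [a qa] := pcentral_proj_lift p_prime H1_surj n (repr q).
exists (pcentral_proj p A n.+1 a).
by rewrite pcentral_mapE -qa; exact: gproj_repr.
Qed.
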